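(* Let $1\leqslant m<n$ be two integers and $$G_{m,n}(x,y,z,t)=\left|\begin{array}{cccc}1 & x^m & x^n & x^{m+n} \\ 1 & y^m & y^n & y^{m+n} \\ 1 & z^m & z^n & z^{m+n} \\ 1 & t^m & t^n & t^{m+n}\end{array}\right|.$$ Then $$G_{m,n}(x,y,z,t)=(y-x)(z-x)(t-x)(t-y)(z-y)(t-z)\sum_{k=m}^{n-1}\sum_{j=0}^{m-1}\sum_{p=0}^{m-1}\sum_{s=k-p}^{n-1}\sum_{r=0}^{k-j-1}x^{2m+n-3-k-p-j}\,y^{n+k-2-r-s}\,z^{j+r}t^{j+r}\,\sigma_{p+s-j-r-1}(z,t).$$
   Context: For a non-negative integer $k$, $\sigma_k(x,y):=\sum_{i=0}^{k}x^{k-i}y^i$. Here $x,y,z,t$ are indeterminates (the formula is a polynomial identity). *)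

(* Defs.v *)
From HB Require Import structures.
From mathcomp Require Import all_boot all_order all_algebra.
From mathcomp Require Import mpoly.
Set Implicit Arguments.
Unset Strict Implicit.
Unset Printing Implicit Defensive.
Import GRing.Theory.
Local Open Scope ring_scope.

Definition sigma (A : comNzRingType) (k : nat) (x y : A) : A :=
  \sum_(0 <= i < k.+1) x ^+ (k - i) * y ^+ i.

Definition Gmx (A : comNzRingType) (m n : nat) (x y z t : A) : 'M[A]_4 :=
  \matrix_(i < 4, j < 4)
    tnth [tuple x; y; z; t] i ^+ tnth [tuple 0%N; m; n; (m + n)%N] j.

Definition G (A : comNzRingType) (m n : nat) (x y z t : A) : A :=
  \det (Gmx m n x y z t).

(* Main.v *)
Require Import Defs.
From HB Require Import structures.
From mathcomp Require Import all_boot all_order all_algebra.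
From mathcomp Require Import mpoly.
From mathcomp Require Import zify ring.
Set Implicit Arguments.
Unset Strict Implicit.
Unset Printing Implicit Defensive.
Import GRing.Theory.
Local Open Scope ring_scope.

(** Both sides come from eliminating one variable at a time, which never needs
    a division, so the identity holds for any four elements of any commutative
    ring.

    Eliminating [x]: column operations with coefficients powers of [x] clear
    the row of [x] outside its first entry, and turn the row of [u] (for [u]
    one of [y], [z], [t]) into [u^m - x^m], [u^n - x^(n-m) u^m] and
    [u^n (u^m - x^m)] ([G_reduced]).  Each of these is [u - x] times a
    geometric sum ([geometric_sum]), with summation index [j] in [0, m), [k] in
    [m, n) and [p] in [0, m) respectively.  Taking [u - x] out of each row and
    expanding by multilinearity leaves the 3 x 3 alternants with rows
    [(u^j, u^k, u^(n+p))], weighted by [x^(2m+n-3-k-p-j)].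

    Eliminating [y] from the alternant of exponents [a <= b <= c] in the same
    way ([alternant_branching]) gives a sum over [q] in [a, b) and [s] in
    [b, c) of the 2 x 2 alternants [z^q t^s - z^s t^q]; this is the branching
    rule of Schur functions, [q] and [s] interlacing [a, b, c].  As [q < s],
    each 2 x 2 alternant is [(t - z) (z t)^q sigma_(s-q-1)(z, t)].  With
    [(a, b, c) = (j, k, n + p)], [q = j + r] and [s] shifted by [p], this is the
    stated sum. *)

(** * Geometric sums *)

Section Elimination.
Variable A : comNzRingType.
Implicit Types (x y z t u : A) (f g h : A -> A).

(** [subrXX] multiplied by [u^a], so that the sum runs over the actual
    exponents of [u]; once [u - x] is distributed, it telescopes. *)
Lemma geometric_sum x u a b : (a <= b)%N ->
  (u - x) * (\sum_(a <= q < b) x ^+ (b - 1 - q) * u ^+ q) =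
  u ^+ b - x ^+ (b - a) * u ^+ a.
Proof.
move=> leab; rewrite mulr_sumr.
pose F q := x ^+ (b - q) * u ^+ q.
rewrite (eq_big_nat _ _ (F2 := fun q => F q.+1 - F q)) => [|q /andP[_ ltqb]].
  by rewrite telescope_sumr // /F subnn expr0 mul1r.
rewrite /F -subnDA add1n -[X in _ - x ^+ X * _](subnSK ltqb) !exprS.
ring.
Qed.

Lemma sigma_telescope z t d : (t - z) * sigma d z t = t ^+ d.+1 - z ^+ d.+1.
Proof.
have := geometric_sum z t (leq0n d.+1).
by rewrite /sigma subSS subn0 expr0 mulr1 subn0.
Qed.

(** * Alternants in three variables *)

(** The determinant with rows [(f u, g u, h u)] for [u = y, z, t], written out
    so that it can be expanded by [ring]. *)
Definition alternant3 f g h y z t : A :=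
  f y * (g z * h t - h z * g t) - g y * (f z * h t - h z * f t)
  + h y * (f z * g t - g z * f t).

Lemma alternant3_swap12 f g h y z t :
  alternant3 f g h y z t = - alternant3 g f h y z t.
Proof. by rewrite /alternant3; ring. Qed.

Lemma alternant3_swap13 f g h y z t :
  alternant3 f g h y z t = - alternant3 h g f y z t.
Proof. by rewrite /alternant3; ring. Qed.

Lemma alternant3_sum1 I (r : seq I) (c : I -> A) (F : I -> A -> A) g h y z t :
  alternant3 (fun u => \sum_(i <- r) c i * F i u) g h y z t =
  \sum_(i <- r) c i * alternant3 (F i) g h y z t.
Proof.
have cofactors f : alternant3 f g h y z t =
    f y * (g z * h t - h z * g t) - f z * (g y * h t - h y * g t)
    + f t * (g y * h z - h y * g z).
  by rewrite /alternant3; ring.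
rewrite cofactors !mulr_suml -sumrB -big_split /=; apply: eq_bigr => i _.
by rewrite cofactors; ring.
Qed.

Lemma alternant3_sum2 I (r : seq I) (c : I -> A) (F : I -> A -> A) f h y z t :
  alternant3 f (fun u => \sum_(i <- r) c i * F i u) h y z t =
  \sum_(i <- r) c i * alternant3 f (F i) h y z t.
Proof.
rewrite alternant3_swap12 alternant3_sum1 -sumrN; apply: eq_bigr => i _.
by rewrite alternant3_swap12 mulrN opprK.
Qed.

Lemma alternant3_sum3 I (r : seq I) (c : I -> A) (F : I -> A -> A) f g y z t :
  alternant3 f g (fun u => \sum_(i <- r) c i * F i u) y z t =
  \sum_(i <- r) c i * alternant3 f g (F i) y z t.
Proof.
rewrite alternant3_swap13 alternant3_sum1 -sumrN; apply: eq_bigr => i _.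
by rewrite alternant3_swap13 mulrN opprK.
Qed.

(** Two-variable case: an alternant of exponents [q < s] is the Vandermonde
    factor [t - z] times the Schur polynomial of shape [(s - 1, q)]. *)
Lemma alternant2_sigma z t q s : (q < s)%N ->
  z ^+ q * t ^+ s - t ^+ q * z ^+ s =
  (t - z) * (z ^+ q * t ^+ q * sigma (s - q - 1) z t).
Proof.
move=> ltqs; rewrite mulrCA sigma_telescope.
have -> : (s - q - 1).+1 = (s - q)%N by lia.
rewrite -{1 2}(subnK (ltnW ltqs)) !exprD; ring.
Qed.

(** The branching rule: subtracting [y^(c-b)] times the second column from the
    third, then [y^(b-a)] times the first from the second, leaves [y^a] alone
    in the row of [y] and multiples of [u - y] in the rows of [u = z, t]. *)
Lemma alternant_branching y z t a b c : (a <= b <= c)%N ->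
  alternant3 (fun u => u ^+ a) (fun u => u ^+ b) (fun u => u ^+ c) y z t =
  (t - y) * (z - y) * (t - z) *
  \sum_(b <= s < c) \sum_(a <= q < b)
    y ^+ (a + (c - 1 - s) + (b - 1 - q)) *
    (z ^+ q * t ^+ q * sigma (s - q - 1) z t).
Proof.
case/andP=> leab lebc.
pose Q u := \sum_(a <= q < b) y ^+ (b - 1 - q) * u ^+ q.
pose S u := \sum_(b <= s < c) y ^+ (c - 1 - s) * u ^+ s.
have eliminate : alternant3 (fun u => u ^+ a) (fun u => u ^+ b)
    (fun u => u ^+ c) y z t =
    y ^+ a * (((z - y) * Q z) * ((t - y) * S t)
              - ((t - y) * Q t) * ((z - y) * S z)).
  rewrite !geometric_sum // /alternant3.
  have -> : y ^+ c = y ^+ (c - b) * y ^+ b by rewrite -exprD subnK.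
  have -> : y ^+ b = y ^+ (b - a) * y ^+ a by rewrite -exprD subnK.
  ring.
transitivity ((t - y) * (z - y) * (y ^+ a * (S t * Q z - S z * Q t))).
  by rewrite eliminate; ring.
rewrite -[RHS]mulrA; congr (_ * _).
rewrite /S /Q !big_distrlr /= -sumrB !mulr_sumr.
apply: eq_big_nat => s /andP[lebs _].
rewrite -sumrB !mulr_sumr; apply: eq_big_nat => q /andP[_ ltqb].
rewrite [RHS]mulrCA -alternant2_sigma ?(leq_trans ltqb) // !exprD; ring.
Qed.

(** * Elimination of the first variable *)

(** The column operations are [C4 - x^m C3], then [C3 - x^(n-m) C2], then
    [C2 - x^m C1].  The coefficient [x^(n-m)], rather than a subtraction of
    [x^n C1] from [C3], makes the later sum over [k] start at [m] instead of
    [0]. *)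
Lemma G_reduced m n x y z t : (m <= n)%N ->
  G m n x y z t =
  alternant3 (fun u => u ^+ m - x ^+ m)
             (fun u => u ^+ n - x ^+ (n - m) * u ^+ m)
             (fun u => u ^+ (n + m) - x ^+ m * u ^+ n) y z t.
Proof.
move=> lemn; rewrite /G (expand_det_row _ ord0) !big_ord_recl big_ord0 /cofactor.
rewrite !(expand_det_row _ ord0) !big_ord_recl !big_ord0 /cofactor.
rewrite !(expand_det_row _ ord0) !big_ord_recl !big_ord0 /cofactor.
rewrite !det_mx11 !mxE /=.
rewrite /tnth /= !expr0 /alternant3.
have sign1 : (-1) ^+ (0 + bump 0 0) = -1 :> A by rewrite -signr_odd expr1.
have sign2 : (-1) ^+ (0 + bump 0 (bump 0 0)) = 1 :> A by rewrite -signr_odd.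
have sign3 : (-1) ^+ (0 + bump 0 (bump 0 (bump 0 0))) = -1 :> A.
  by rewrite -signr_odd expr1.
rewrite sign1 sign2 sign3 !exprD.
have -> : x ^+ n = x ^+ (n - m) * x ^+ m by rewrite -exprD subnK.
ring.
Qed.

Lemma G_alternants m n x y z t : (m <= n)%N ->
  G m n x y z t =
  (y - x) * (z - x) * (t - x) *
  \sum_(m <= k < n) x ^+ (n - 1 - k) *
    \sum_(0 <= j < m) x ^+ (m - 1 - j) *
      \sum_(0 <= p < m) x ^+ (m - 1 - p) *
        alternant3 (fun u => u ^+ j) (fun u => u ^+ k) (fun u => u ^+ (n + p))
          y z t.
Proof.
move=> lemn; rewrite G_reduced //.
pose P u := \sum_(0 <= j < m) x ^+ (m - 1 - j) * u ^+ j.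
pose K u := \sum_(m <= k < n) x ^+ (n - 1 - k) * u ^+ k.
pose N u := \sum_(0 <= p < m) x ^+ (m - 1 - p) * u ^+ (n + p).
transitivity ((y - x) * (z - x) * (t - x) * alternant3 P K N y z t).
  have PE u : u ^+ m - x ^+ m = (u - x) * P u.
    by rewrite geometric_sum // subn0 expr0 mulr1.
  have NE u : u ^+ (n + m) - x ^+ m * u ^+ n = (u - x) * N u.
    rewrite exprD [u ^+ n * _]mulrC -mulrBl PE -mulrA mulr_suml.
    congr (_ * _); apply: eq_bigr => p _.
    by rewrite exprD -mulrA [u ^+ n * _]mulrC.
  have KE u : u ^+ n - x ^+ (n - m) * u ^+ m = (u - x) * K u.
    by rewrite geometric_sum.
  by rewrite /alternant3 !PE !KE !NE; ring.
congr (_ * _); rewrite (alternant3_sum2 _ _ (fun k u => u ^+ k)).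
apply: eq_bigr => k _; rewrite (alternant3_sum1 _ _ (fun j u => u ^+ j)).
congr (_ * _); apply: eq_bigr => j _; congr (_ * _).
exact: (alternant3_sum3 _ _ (fun p u => u ^+ (n + p))).
Qed.

(** In the inner sum of [alternant_branching], [s + p] and [r + j] are the
    indices called [s] and [q] there. *)
Lemma G_factorization m n x y z t : (m < n)%N ->
  G m n x y z t =
    (y - x) * (z - x) * (t - x) * (t - y) * (z - y) * (t - z) *
    \sum_(m <= k < n) \sum_(0 <= j < m) \sum_(0 <= p < m)
      \sum_(k - p <= s < n) \sum_(0 <= r < k - j)
        x ^+ (2 * m + n - 3 - k - p - j) * y ^+ (n + k - 2 - r - s) *
        z ^+ (j + r) * t ^+ (j + r) * sigma (p + s - j - r - 1) z t.
Proof.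
move=> ltmn; rewrite G_alternants ?(ltnW ltmn) //.
rewrite -!mulrA; do 3 congr (_ * _); rewrite !mulrA.
rewrite mulr_sumr; apply: eq_big_nat => k /andP[lemk ltkn].
rewrite !mulr_sumr; apply: eq_big_nat => j /andP[_ ltjm].
rewrite !mulr_sumr; apply: eq_big_nat => p /andP[_ ltpm].
rewrite alternant_branching; last by apply/andP; split; lia.
rewrite (mulrCA (x ^+ (m - 1 - p))) (mulrCA (x ^+ (m - 1 - j))).
rewrite (mulrCA (x ^+ (n - 1 - k))); congr (_ * _).
have lepk : (p <= k)%N by lia.
rewrite -[X in \big[_/_]_(X <= _ < _) _](subnK lepk) big_addn addnK.
rewrite !mulr_sumr; apply: eq_big_nat => s /andP[leks ltsn].
rewrite -[X in \big[_/_]_(X <= _ < _) _]add0n big_addn.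
rewrite !mulr_sumr; apply: eq_big_nat => r /andP[_ ltrkj].
rewrite !mulrA -!exprD.
by congr (_ ^+ _ * _ ^+ _ * _ ^+ _ * _ ^+ _ * sigma _ _ _); lia.
Qed.
End Elimination.

Theorem theorem3p4 (R : comNzRingType) (m n : nat) (hm : (1 <= m)%N)
    (hmn : (m < n)%N) :
  let x : {mpoly R[4]} := 'X_0 in
  let y : {mpoly R[4]} := 'X_1 in
  let z : {mpoly R[4]} := 'X_2%:R in
  let t : {mpoly R[4]} := 'X_3%:R in
  G m n x y z t =
    (y - x) * (z - x) * (t - x) * (t - y) * (z - y) * (t - z) *
    \sum_(m <= k < n) \sum_(0 <= j < m) \sum_(0 <= p < m)
      \sum_(k - p <= s < n) \sum_(0 <= r < k - j)
        x ^+ (2 * m + n - 3 - k - p - j) * y ^+ (n + k - 2 - r - s) *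
        z ^+ (j + r) * t ^+ (j + r) * sigma (p + s - j - r - 1) z t.
Proof. by move=> x y z t; exact: G_factorization. Qed.
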